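(* There exist an abelian paratopological group $G$ that is saturated, regular and $\flat$-regular, and a subgroup $H$ of $G$ such that $H$ is discrete in the subspace topology inherited from $G$, $H$ is closed in $G^\flat$ (hence closed in $G$), and the quotient paratopological group $G/H$, endowed with the quotient topology, is Hausdorff but not regular.
   Context: A paratopological group is a group $G$ endowed with a topology $\tau$ making the group operation $G\times G\to G$ continuous (inversion need not be continuous). For a normal subgroup $H$ of $G$, the quotient group $G/H$ with the quotient topology is again a paratopological group. The group reflexion $G^\flat=(G,\tau^\flat)$ of a paratopological group $(G,\tau)$ is the group $G$ endowed with the strongest topology $\tau^\flat\subset\tau$ turning $G$ into a topological group. A paratopological group $(G,\tau)$ is $\flat$-regular if it has a neighborhood base (with respect to $\tau$) at the neutral element consisting of sets that are closed in $\tau^\flat$. It is saturated if for each neighborhood $U$ of the neutral element in $G$ the set $U^{-1}$ has non-empty interior in $G$. A regular space is a Hausdorff space in which every point has a neighborhood base of closed sets. *)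

(* Defs.v *)
From HB Require Import structures.
From mathcomp Require Import all_boot all_algebra finmap.
From mathcomp Require Import all_classical topology tvs.

Set Implicit Arguments.
Unset Strict Implicit.
Unset Printing Implicit Defensive.

Import GRing.Theory.

Local Open Scope classical_set_scope.
Local Open Scope ring_scope.
Local Open Scope quotient_scope.

(* Abelian groups are written additively: the neutral element is 0 and the
   inverse of x is - x.                                                      *)

(* A paratopological group: addition is continuous, opposite need not be.
   A mixin separate from the one of TopologicalNmodule is used because the join
   of TopologicalNmodule and Zmodule cannot be inserted below the existing
   TopologicalZmodule.                                                       *)
HB.mixin Record PreTopologicalZmodule_isParatopological M
    & Topological M & GRing.Zmodule M := {
  paratop_add_continuous : continuous (fun x : M * M => x.1 + x.2)
}.

#[short(type="paratopologicalZmodType")]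
HB.structure Definition ParatopologicalZmodule :=
  {M of Topological M & GRing.Zmodule M
        & PreTopologicalZmodule_isParatopological M}.

Section GroupReflexion.
Variable G : paratopologicalZmodType.

Record coarser_group_topology := CoarserGroupTopology {
  cgt_class : Topological G;
  cgt_space := Topological.Pack cgt_class;
  cgt_add : continuous
    (fun x : cgt_space * cgt_space => ((x.1 : G) + (x.2 : G) : cgt_space));
  cgt_opp : continuous (fun x : cgt_space => (- (x : G) : cgt_space));
  cgt_coarser : forall A : set G, open (A : set cgt_space) -> open A
}.

(* The supremum of all group topologies coarser than the topology of G; by
   group_reflexion_open and group_reflexion_max and the instance of
   TopologicalZmodule below, it is the strongest of them.                    *)
Definition group_reflexion : Type := sup_topology cgt_class.

HB.instance Definition _ := Topological.copy group_reflexion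
  (sup_topology cgt_class).
HB.instance Definition _ := GRing.Zmodule.copy group_reflexion G.

Lemma group_reflexion_cvg (t : coarser_group_topology) (x : G) :
  nbhs (x : group_reflexion) --> (x : cgt_space t).
Proof. by move: t; apply/(@cvg_sup _ _ cgt_class). Qed.

Lemma group_reflexion_cvgP (F : set_system G) (x : G) : Filter F ->
  (forall t : coarser_group_topology, F --> (x : cgt_space t)) ->
  F --> (x : group_reflexion).
Proof. by move=> FF Fx; apply/(@cvg_sup _ _ cgt_class). Qed.

Lemma group_reflexion_max (t : coarser_group_topology) (A : set G) :
  open (A : set (cgt_space t)) -> open (A : set group_reflexion).
Proof.
move=> oA; rewrite openE => x Ax; apply: (@group_reflexion_cvg t x).
exact: open_nbhs_nbhs.
Qed.

Lemma group_reflexion_open (A : set G) :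
  open (A : set group_reflexion) -> open A.
Proof.
rewrite openE => oA; rewrite openE => x /oA.
suff : nbhs x --> (x : sup_topology cgt_class) by apply.
apply/cvg_sup => t B; rewrite nbhsE => -[C [oC Cx] CB].
rewrite nbhs_filterE; apply: filterS CB _; apply: open_nbhs_nbhs; split => //.
exact: (@cgt_coarser t).
Qed.

Fact group_reflexion_add_continuous :
  continuous
    (fun x : group_reflexion * group_reflexion => x.1 + x.2 : group_reflexion).
Proof.
move=> x.
pose f (y : group_reflexion * group_reflexion) : G := y.1 + y.2.
apply: (@group_reflexion_cvgP (fmap f (nbhs x)) (f x)) => t.
move=> B /(@cgt_add t (x.1, x.2))[[U V] /= [xU xV] UV].
exists (U, V); last by move=> y; exact: UV.
by split; exact: (@group_reflexion_cvg t).
Qed.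

Fact group_reflexion_opp_continuous :
  continuous (-%R : group_reflexion -> group_reflexion).
Proof.
move=> x; pose f (y : group_reflexion) : G := - y.
have ? : Filter (fmap f (nbhs x)).
  by apply: fmap_filter; exact: (@nbhs_filter group_reflexion x).
apply: (@group_reflexion_cvgP (fmap f (nbhs x)) (f x)) => t.
have := @cgt_opp t x.
by apply: cvg_trans; apply: cvg_app; exact: group_reflexion_cvg.
Qed.

HB.instance Definition _ :=
  PreTopologicalNmodule_isTopologicalNmodule.Build group_reflexion
    group_reflexion_add_continuous.
HB.instance Definition _ :=
  TopologicalNmodule_isTopologicalZmodule.Build group_reflexion
    group_reflexion_opp_continuous.

End GroupReflexion.

Section QuotientGroup.
Variables (G : paratopologicalZmodType) (H : zmodClosed G).

Definition quotient_group : Type := quotient_topology (Quotient.quot H).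

HB.instance Definition _ := Topological.copy quotient_group
  (quotient_topology (Quotient.quot H)).
(* Not a copy of the Zmodule structure of Quotient.quot H, whose choiceType
   structure differs from the one that quotient_topology carries.            *)
HB.instance Definition _ := GRing.isZmodule.Build quotient_group
  (@Quotient.addqA G H) (@Quotient.addqC G H) (@Quotient.add0q G H)
  (@Quotient.addNq G H).

Definition quotient_pi : G -> quotient_group := \pi_(Quotient.quot H).

Lemma quotient_piD (x y : G) :
  quotient_pi (x + y) = quotient_pi x + quotient_pi y.
Proof. exact: (@Quotient.pi_add _ H x y). Qed.

Lemma quotient_pi_surj (p : quotient_group) : exists x, quotient_pi x = p.
Proof. by exists (repr (p : Quotient.quot H)); exact: reprK. Qed.

Lemma quotient_pi_eq (x y : G) : quotient_pi x = quotient_pi y <-> x - y \in H.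
Proof.
by rewrite Quotient.idealrBE; split => [e|/eqP e]; [apply/eqP; exact: e|].
Qed.

Lemma addr_continuous (a : G) : continuous (fun x : G => x + a).
Proof.
move=> x.
apply: (@continuous_comp _ _ _ (fun y : G => (y, a))
  (fun z : G * G => z.1 + z.2)); last exact: paratop_add_continuous.
by apply: cvg_pair => /=; [exact: cvg_id|exact: cvg_cst].
Qed.

Lemma quotient_pi_nbhs (x : G) (U : set G) :
  nbhs x U -> nbhs (quotient_pi x) (quotient_pi @` U).
Proof.
rewrite nbhsE => -[V [oV Vx] VU].
apply: (@filterS _ _ _ (quotient_pi @` V)); first exact: image_subset.
apply: open_nbhs_nbhs; split; last by exists x.
suff : open (quotient_pi @^-1` (quotient_pi @` V)) by [].
rewrite openE => y [v Vv /quotient_pi_eq vyH].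
have /(@addr_continuous (v - y) y) : nbhs (y + (v - y)) V.
  by rewrite addrC subrK; exact: open_nbhs_nbhs.
move=> yV; apply: (@filterS _ (nbhs y) _ _ _ _ yV) => z Vz.
exists (z + (v - y)) => //.
by apply/quotient_pi_eq; rewrite addrAC subrr add0r.
Qed.

Fact quotient_group_add_continuous :
  continuous
    (fun x : quotient_group * quotient_group => x.1 + x.2 : quotient_group).
Proof.
move=> [p q] W /=.
have [a <-] := quotient_pi_surj p; have [b <-] := quotient_pi_surj q.
rewrite -quotient_piD => /(@pi_continuous _ (Quotient.quot H)).
move=> /(@paratop_add_continuous G (a, b))[[U V] /= [aU bV] UV].
exists (quotient_pi @` U, quotient_pi @` V).
  by split; exact: quotient_pi_nbhs.
move=> [_ _] /= [[u Uu <-] [v Vv <-]].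
by rewrite -quotient_piD; exact: (UV (u, v)).
Qed.

HB.instance Definition _ := PreTopologicalZmodule_isParatopological.Build
  quotient_group quotient_group_add_continuous.

End QuotientGroup.

(* The library's regular_space (closed neighborhoods form a base at each point)
   does not include the Hausdorff axiom.                                     *)
Definition regular_hausdorff (T : topologicalType) : Prop :=
  hausdorff_space T /\ regular_space T.

Definition flat_closed (G : paratopologicalZmodType) (A : set G) : Prop :=
  closed (A : set (group_reflexion G)).

Definition flat_regular (G : paratopologicalZmodType) : Prop :=
  forall U : set G, nbhs 0 U ->
    exists F : set G,
      [/\ nbhs 0 F, flat_closed F & F `<=` U].

Definition saturated (G : paratopologicalZmodType) : Prop :=
  forall U : set G, nbhs 0 U -> interior [set - x | x in U] !=set0.

Definition discrete_subspace (T : topologicalType) (A : set T) : Prop :=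
  forall B : set (set_type A), open B.

(* Main.v *)
Require Import Defs.
From HB Require Import structures.
From mathcomp Require Import all_boot all_algebra.
From mathcomp Require Import all_classical topology tvs.
From mathcomp Require Import all_order reals Rstruct lra.

(** Let R be an archimedean ordered field containing an irrational number, let
  G = R x Q x R with basic neighborhoods of 0 the truncated cones
  P_e = {(t, a, b) : |b| <= t <= e, |a| <= e}, and H = {(0, q, q) : q in Q}.
  The sup norm topology is a coarser group topology in which the P_e and H are
  closed, and P_e meets H only in 0.  If x belongs to H + P_e - P_e for every e
  then x belongs to H, so G/H is Hausdorff.  It is not regular: for irrational
  v with 0 < v < e and 0 < t <= e,
    (t, 0, v) = (t, - q, v - q) + (0, q, q)
  belongs to P_e + H as soon as q is a rational number in ]0, v[ with
  v - q <= t, so that the image of (0, 0, v) lies in the closure of that of P_e;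
  but (0, 0, v) does not belong to P_1 + H, as the elements (0, a, b) of P_1
  have b = 0. *)

Set Implicit Arguments.
Unset Strict Implicit.
Unset Printing Implicit Defensive.

Import Order.TTheory GRing.Theory Num.Theory.

Local Open Scope classical_set_scope.
Local Open Scope ring_scope.

(** * Closedness and regularity inherited from the group reflexion *)

Lemma flat_closed_closed (G : paratopologicalZmodType) (A : set G) :
  flat_closed A -> closed A.
Proof. by rewrite /flat_closed -!openC; exact: group_reflexion_open. Qed.

(** Translations are continuous, so a closed neighborhood of 0 found in the translate of [A] can be
    moved back to [x]. *)
Lemma flat_regular_regular (G : paratopologicalZmodType) :
  flat_regular G -> regular_space G.
Proof.
move=> frG x A xA.
have : nbhs 0 ((fun y : G => y + x) @^-1` A).
  by apply: (@addr_continuous G x 0); rewrite add0r.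
move=> /frG[F [F0 /flat_closed_closed cF FA]].
pose s := fun y : G => y - x.
exists (s @^-1` F); first by apply: (@addr_continuous G (- x) x); rewrite subrr.
have /closure_id <- : closed (s @^-1` F).
  by apply: closed_comp => // y _; exact: addr_continuous.
by move=> y /FA; rewrite /s /= subrK.
Qed.

(** * Paratopological groups given by a filter at 0 *)

Record zero_filter (X : zmodType) := ZeroFilter {
  zero_nbhs : set_system X;
  zero_filter_filter : Filter zero_nbhs;
  zero_filter0 : forall U, zero_nbhs U -> U 0;
  zero_filterD : forall U, zero_nbhs U ->
    exists2 V, zero_nbhs V & forall x y, V x -> V y -> U (x + y)
}.

#[global] Existing Instance zero_filter_filter.

(** An alias of [X] indexed by the filter, so that one group can carry both the box and the cone
    topology. *)
Definition translation_space (X : zmodType) of zero_filter X : Type := X.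

Section TranslationSpace.
Variables (X : zmodType) (F : zero_filter X).
Local Notation T := (translation_space F).

HB.instance Definition _ := GRing.Zmodule.copy T X.

Definition translation_nbhs (x : X) : set_system X := +%R x @ zero_nbhs F.

HB.instance Definition _ := hasNbhs.Build T translation_nbhs.

Fact translation_nbhs_filter (x : T) : ProperFilter (nbhs x).
Proof.
by apply: Build_ProperFilter_ex => A /(@zero_filter0 _ F) ?; exists (x + 0).
Qed.

Fact translation_nbhs_singleton (x : T) (A : set T) : nbhs x A -> A x.
Proof. by move/(@zero_filter0 _ F); rewrite /= addr0. Qed.

Fact translation_nbhs_nbhs (x : T) (A : set T) : nbhs x A -> nbhs x (nbhs^~ A).
Proof.
move=> /(@zero_filterD _ F)[V FV VA].
(* As [x + V + V] lies in [A], the set [A] is a neighborhood of [x + u] for every [u] in [V]. *)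
apply: (@filterS _ (zero_nbhs F) _ V) (FV) => u Vu.
apply: (@filterS _ (zero_nbhs F) _ V) FV => v Vv.
by rewrite /= -addrA; exact: VA.
Qed.

HB.instance Definition _ := Nbhs_isNbhsTopological.Build T
  translation_nbhs_filter translation_nbhs_singleton translation_nbhs_nbhs.

Fact translation_add_continuous : continuous (fun x : T * T => x.1 + x.2).
Proof.
move=> [x y] A /(@zero_filterD _ F)[V FV VA].
exists ([set x + u | u in V], [set y + u | u in V]) => /=.
  by split; apply: (@filterS _ (zero_nbhs F) _ V) => // u Vu; exists u.
move=> [_ _] /= [[u Vu <-] [v Vv <-]].
by rewrite /= addrACA; exact: VA.
Qed.

HB.instance Definition _ := PreTopologicalZmodule_isParatopological.Build
  T translation_add_continuous.

Lemma translation_opp_continuous :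
    (forall U, zero_nbhs F U -> zero_nbhs F (-%R @^-1` U)) ->
  continuous (-%R : T -> T).
Proof.
move=> FN x A /FN; apply: (@filterS _ (zero_nbhs F)) => u.
by rewrite /= opprD.
Qed.

End TranslationSpace.

(** * Flat-closed sets from a coarser group topology *)

Section CoarserTranslation.
Variables (X : zmodType) (E F : zero_filter X).
Hypotheses (EN : forall U, zero_nbhs E U -> zero_nbhs E (-%R @^-1` U)).
Hypotheses (EF : zero_nbhs E `<=` zero_nbhs F).

(** Kept transparent, so that its [cgt_space] unfolds to [translation_space E] when
    [group_reflexion_max] is applied to it. *)
Definition coarser_translation_topology :
  coarser_group_topology (translation_space F).
Proof.
refine (@CoarserGroupTopology (translation_space F)
  (Topological.class (translation_space E)) _ _ _).
- exact: (@translation_add_continuous X E).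
- exact: (translation_opp_continuous EN).
- move=> A oA; rewrite openE => x Ax.
  apply: EF.
  by move: oA; rewrite (@openE (translation_space E)) => /(_ _ Ax).
Defined.

Lemma translation_flat_closed (A : set (translation_space F)) :
  closed (A : set (translation_space E)) -> flat_closed A.
Proof.
move=> cA; rewrite /flat_closed -openC.
apply: (@group_reflexion_max _ coarser_translation_topology).
by move: cA; rewrite -openC.
Qed.

End CoarserTranslation.

(** * Filters generated by a monotone one-parameter family *)

Section FamilyZeroFilter.
Variables (R : realFieldType) (X : zmodType) (P : R -> set X).
Hypotheses (P0 : forall e, 0 < e -> P e 0)
  (Pmono : forall e d, e <= d -> P e `<=` P d)
  (PD : forall e x y, P (e / 2) x -> P (e / 2) y -> P e (x + y)).

Fact family_filter : Filter (filter_from [set e | 0 < e] P).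
Proof.
apply: filter_from_filter; first by exists 1; exact: ltr01.
move=> e d /= e0 d0; exists (Num.min e d); first by rewrite /= lt_min e0.
by move=> x Px; split; apply: Pmono Px; rewrite ge_min lexx ?orbT.
Qed.

Fact family_filter0 (U : set X) : filter_from [set e | 0 < e] P U -> U 0.
Proof. by move=> [e /= e0]; apply; exact: P0. Qed.

Fact family_filterD (U : set X) : filter_from [set e | 0 < e] P U ->
  exists2 V, filter_from [set e | 0 < e] P V &
    forall x y, V x -> V y -> U (x + y).
Proof.
move=> [e /= e0 PU]; exists (P (e / 2)).
  by exists (e / 2) => //=; rewrite divr_gt0.
by move=> x y Px Py; apply/PU/PD.
Qed.

Definition family_zero_filter : zero_filter X :=
  ZeroFilter family_filter family_filter0 family_filterD.

End FamilyZeroFilter.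

(** Reduces an equality to linear inequalities with arbitrary error, which [lra] derives from
    membership in small boxes or cones. *)
Lemma eq_approx (R : realFieldType) (x y : R) :
  (forall e, 0 < e -> x - e <= y <= x + e) -> x = y.
Proof.
move=> h; apply/eqP; rewrite eq_le.
by apply/andP; split; apply/ler_addgt0Pr => e /h; lra.
Qed.

(** * The cone group and its subgroup [graph] *)

Section Example.
Variable R : archiRealFieldType.

Let X : zmodType := (R * rat * R)%type.

Definition box (e : R) (p : X) : Prop :=
  [/\ - e <= p.1.1 <= e, - e <= ratr p.1.2 <= e & - e <= p.2 <= e].

Definition cone (e : R) (p : X) : Prop :=
  [/\ p.1.1 <= e, - e <= ratr p.1.2 <= e & - p.1.1 <= p.2 <= p.1.1].

Fact box0 (e : R) : 0 < e -> box e 0.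
Proof. by move=> e0; split; rewrite /= ?rmorph0; lra. Qed.

Fact box_mono (e d : R) : e <= d -> box e `<=` box d.
Proof. by move=> ed p []; split; lra. Qed.

Fact boxD (e : R) (p q : X) : box (e / 2) p -> box (e / 2) q -> box e (p + q).
Proof. by move=> [? ? ?] [? ? ?]; split; rewrite /= ?rmorphD; lra. Qed.

Fact cone0 (e : R) : 0 < e -> cone e 0.
Proof. by move=> e0; split; rewrite /= ?rmorph0; lra. Qed.

Fact cone_mono (e d : R) : e <= d -> cone e `<=` cone d.
Proof. by move=> ed p []; split; lra. Qed.

Fact coneD (e : R) (p q : X) :
  cone (e / 2) p -> cone (e / 2) q -> cone e (p + q).
Proof. by move=> [? ? ?] [? ? ?]; split; rewrite /= ?rmorphD; lra. Qed.

Lemma cone_box (e : R) : cone e `<=` box e.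
Proof. by move=> p []; split; lra. Qed.

Definition box_filter := family_zero_filter box0 box_mono boxD.
Definition cone_filter := family_zero_filter cone0 cone_mono coneD.

Definition cone_group : paratopologicalZmodType :=
  translation_space cone_filter.

Lemma box_filterN (U : set X) :
  zero_nbhs box_filter U -> zero_nbhs box_filter (-%R @^-1` U).
Proof.
move=> [e e0 eU]; exists e => // p [? ? ?]; apply: eU.
by split; rewrite /= ?rmorphN; lra.
Qed.

Lemma box_filter_cone : zero_nbhs box_filter `<=` zero_nbhs cone_filter.
Proof.
by move=> U [e e0 eU]; exists e => //; exact: subset_trans (@cone_box e) eU.
Qed.

Lemma nbhs_cone (x : cone_group) (A : set cone_group) :
  nbhs x A <-> exists2 e : R, 0 < e & forall u, cone e u -> A (x + u).
Proof. by []. Qed.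

(** The box topology is a group topology coarser than the cone topology, so closedness for it
    suffices and the reflexion need not be computed. *)
Lemma cone_flat_closed (A : set X) :
  (forall p, (forall e : R, 0 < e -> exists2 u, box e u & A (p + u)) -> A p) ->
  flat_closed (A : set cone_group).
Proof.
move=> hA; apply: (translation_flat_closed box_filterN box_filter_cone).
move=> p cp; apply: hA => e e0.
have [|q [Aq [u bu uq]]] := cp [set p + u | u in box e].
  by exists e => // u bu; exists u.
by exists u => //; rewrite uq.
Qed.

(** The cone is cut out by weak linear inequalities in at most two coordinates; each holds for [p]
    up to an arbitrary error [d], hence exactly. *)
Lemma flat_closed_cone (e : R) : flat_closed (cone e : set cone_group).
Proof.
apply: cone_flat_closed => p h.
have {}h d : 0 < d -> exists u, box (d / 4) u /\ cone e (p + u).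
  by move=> d0; have [|u] := h (d / 4); [lra|exists u].
by split; [|apply/andP; split..]; apply/ler_addgt0Pr => d /h
  [u [[/= ? ? ?] []]]; rewrite /= ?rmorphD /=; lra.
Qed.

Definition graph : {pred cone_group} :=
  fun p => (p.1.1 == 0) && (ratr p.1.2 == p.2).

Lemma graphP (p : cone_group) :
  reflect (p.1.1 = 0 /\ ratr p.1.2 = p.2) (p \in graph).
Proof.
by apply: (iffP andP) => -[/eqP ? /eqP ?].
Qed.

Fact graph_zmod_closed : zmod_closed graph.
Proof.
split=> [|p q /graphP[p1 p2] /graphP[q1 q2]]; apply/graphP.
  by rewrite /= rmorph0.
by rewrite /= rmorphB /= p1 q1 p2 q2 subrr.
Qed.

HB.instance Definition _ := GRing.isZmodClosed.Build cone_group graph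
  graph_zmod_closed.

Definition graph_subgroup : zmodClosed cone_group := graph.

(** On [graph] the first coordinate is 0, which forces the third to vanish in a cone, and then the
    second by injectivity of [ratr]. *)
Lemma cone_graph (e : R) (p : cone_group) : cone e p -> p \in graph -> p = 0.
Proof.
case: p => [[t a] b] [/= _ _ bt] /graphP[/= t0 ab].
have b0 : b = 0 by lra.
have a0 : a = 0.
  by apply: (fmorph_inj (@ratr R)); rewrite rmorph0; exact: etrans ab b0.
by rewrite t0 a0 b0.
Qed.

Lemma cone_group_saturated : saturated cone_group.
Proof.
(* The point [(e / 2, 0, 0)] is well inside [cone e]: moved by the opposite of an element of
   [cone (e / 4)] it stays there. *)
move=> U /nbhs_cone[e e0 eU]; exists ((- (e / 2), 0, 0) : X).
apply/nbhs_cone; exists (e / 4) => [|u [? ? ?]]; first by lra.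
exists (- ((- (e / 2), 0, 0) + u : X)); last by rewrite opprK.
rewrite -[X in U X]add0r; apply: eU.
by split; rewrite /= ?rmorphN ?rmorphD ?rmorph0 /=; lra.
Qed.

Lemma cone_group_hausdorff : hausdorff_space cone_group.
Proof.
move=> x y xy.
have {}xy e : 0 < e -> exists u w, [/\ cone e u, cone e w & x + u = y + w].
  move=> e0; have [||_ [[u cu <-] [w cw]]] :=
    xy [set x + u | u in cone e] [set y + w | w in cone e].
  - by apply/nbhs_cone; exists e => // u cu; exists u.
  - by apply/nbhs_cone; exists e => // u cu; exists u.
  - by exists u, w.
(* A difference of two small cone elements is only small in the sup norm, which is enough to
   separate points. *)
have {}xy e : 0 < e -> box e (x - y).
  move=> e0; have [|u [w [[? ? ?] [? ? ?] uw]]] := xy (e / 4); first by lra.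
  have -> : x - y = w - u.
    by apply/eqP; rewrite subr_eq addrAC eq_sym subr_eq uw addrC.
  by split; rewrite /= ?rmorphB; lra.
case: x y xy => [[xt xa] xb] [[yt ya] yb] xy.
congr (_, _, _); last 1 first.
- by apply: eq_approx => e /xy[]; rewrite /=; lra.
- by apply: eq_approx => e /xy[]; rewrite /=; lra.
apply: (fmorph_inj (@ratr R)); apply: eq_approx => e /xy[_ + _].
by rewrite /= rmorphB /=; lra.
Qed.

Lemma cone_group_flat_regular : flat_regular cone_group.
Proof.
move=> U /nbhs_cone[e e0 eU]; exists (cone e); split.
- by apply/nbhs_cone; exists e => // u; rewrite add0r.
- exact: flat_closed_cone.
- by move=> u /eU; rewrite add0r.
Qed.

Lemma graph_flat_closed : flat_closed [set` graph].
Proof.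
apply: cone_flat_closed => p h; apply/graphP; split.
  apply: eq_approx => e /h[u [? ? ?] /graphP[/= + _]]; lra.
apply: eq_approx => e e0.
have [|u [? ? ?] /graphP[_ /=]] := h (e / 2); first lra.
by rewrite rmorphD /=; lra.
Qed.

(** Two points of [graph] differing by an element of [cone 1] are equal, by [cone_graph]. *)
Lemma graph_discrete : discrete_subspace [set` graph].
Proof.
move=> B; rewrite openE => x Bx.
have : nbhs (set_val x : cone_group) [set set_val x + u | u in cone 1].
  by apply/nbhs_cone; exists 1 => [|u cu]; [exact: ltr01|exists u].
move=> /(@initial_continuous _ _ set_val) nx.
apply: (@filterS _ (nbhs x) _ _ _ _ nx) => y [u cu xuy].
suff yx : val y = val x by rewrite (val_inj yx).
have gx : val x \in graph := set_mem (valP x).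
have gy : val y \in graph := set_mem (valP y).
move: xuy; rewrite -[set_val y]/(val y) -[set_val x]/(val x) => xuy.
have u0 : u = 0.
  apply: (cone_graph cu).
  have -> : u = val y - val x by rewrite -xuy addrC addKr.
  exact: rpredB.
by rewrite -xuy u0 addr0.
Qed.

(** * The quotient: Hausdorff but not regular *)

Local Notation Q := (quotient_group graph).
Local Notation pi := (@quotient_pi cone_group graph).

Lemma nbhs_quotient_cone (x : cone_group) (B : set Q) :
  nbhs (pi x) B -> exists2 e : R, 0 < e & forall u, cone e u -> B (pi (x + u)).
Proof. by move=> /(@pi_continuous _ (Quotient.quot graph)). Qed.

Lemma quotient_cone_hausdorff : hausdorff_space Q.
Proof.
move=> p q; have [x <-] := quotient_pi_surj p.
have [y <-] := quotient_pi_surj q => xy; apply/quotient_pi_eq.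
have {}xy e : 0 < e ->
    exists u w, [/\ cone e u, cone e w & (x + u) - (y + w) \in graph].
  move=> e0; have [||_ [[_ [u cu <-] <-] [_ [w cw <-]]]] :=
    xy (pi @` [set x + u | u in cone e]) (pi @` [set y + w | w in cone e]).
  - by apply/quotient_pi_nbhs/nbhs_cone; exists e => // u cu; exists u.
  - by apply/quotient_pi_nbhs/nbhs_cone; exists e => // u cu; exists u.
  - by move=> /esym/quotient_pi_eq ?; exists u, w.
apply/graphP; split.
  apply: eq_approx => e /xy[u [w [[? ? ?] [? ? ?] /graphP[+ _]]]].
  by rewrite /=; lra.
apply: eq_approx => e e0.
(* The equation compares second and third coordinates, so [u] and [w] contribute four errors of size
   [e / 4]. *)
have [|u [w [[? ? ?] [? ? ?] /graphP[/=]]]] := xy (e / 4); first lra.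
by rewrite !rmorphB !rmorphD /=; lra.
Qed.

Lemma quotient_cone_not_regular (r : R) :
  (forall q, ratr q != r) -> ~ regular_space Q.
Proof.
move=> rirr reg.
have : nbhs (pi 0) (pi @` cone 1).
  by apply/quotient_pi_nbhs/nbhs_cone; exists 1 => [|u]; rewrite ?ltr01 ?add0r.
move=> /reg[V /nbhs_quotient_cone[e e0 eV] clV].
have [v [v0 ve virr]] : exists v : R, [/\ 0 < v, v < e & forall q, ratr q != v].
  (* Subtracting from [r] a rational close below it gives a small positive irrational. *)
  have /rat_in_itvoo[s /itvP rs] : r - e < r by lra.
  have [rs1 rs2] : r - e < ratr s /\ ratr s < r by rewrite !rs.
  exists (r - ratr s); split; [lra|lra|move=> q].
  apply: contra (rirr (q + s)) => /eqP h.
  by rewrite rmorphD /= h subrK.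
have /clV[[[t a] b] [/= _ _ bt]] : closure V (pi ((0, 0, v) : X)).
  move=> B /nbhs_quotient_cone[d d0 dB].
  (* The bound [c <= d] puts [(c, 0, 0)] in [cone d], and [c <= e] puts [(c, - q, v - ratr q)] in
     [cone e]. *)
  pose c := Num.min d e.
  have [c0 cd ce] : [/\ 0 < c, c <= d & c <= e].
    by rewrite /c lt_min d0 e0 !ge_min !lexx orbT.
  have /rat_in_itvoo[q /itvP vq] : Num.max 0 (v - c) < v.
    by rewrite gt_max v0; lra.
  have [q0 qv] : Num.max 0 (v - c) < ratr q /\ ratr q < v by rewrite !vq.
  move: q0; rewrite gt_max => /andP[q0 vcq].
  exists (pi ((c, 0, v) : X)); split.
    have -> : pi ((c, 0, v) : X) = pi (0 + (c, - q, v - ratr q) : X).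
      apply/quotient_pi_eq/graphP; rewrite /= !add0r !opprK.
      by split; [rewrite subrr|rewrite opprB addrC subrK].
    by apply: eV; split; rewrite /= ?rmorphN /=; lra.
  have -> : ((c, 0, v) : X) = (0, 0, v) + (c, 0, 0).
    by congr (_, _, _); rewrite ?addr0 ?add0r.
  by apply: dB; split; rewrite /= ?rmorph0 /=; lra.
(* Here [t = 0] forces [b = 0], so [v] would be the rational [- a]. *)
move=> /quotient_pi_eq/graphP[/= t0]; rewrite subr0 => ab.
move: (virr (- a)) => /eqP; apply.
by rewrite rmorphN /=; lra.
Qed.

End Example.

(** * Irrationality of the square root of 2, and the conclusion *)

Lemma sqr_rat_neq2 (q : rat) : q ^+ 2 != 2%:R.
Proof.
apply/eqP => q2.
have : ((numq q ^+ 2)%:~R = (2%:R * denq q ^+ 2)%:~R :> rat).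
  rewrite intrM !rmorphXn /= -(q2 : _ = 2%:~R) -exprMn.
  by rewrite -{2}[q]divq_num_den divfK // intr_eq0 denq_neq0.
move=> /intr_inj/(congr1 absz); rewrite abszM !abszX => /(congr1 (logn 2)).
(* The exponent of 2 is even in the squared numerator and odd in twice the squared denominator. *)
rewrite lognM ?expn_gt0 ?absz_gt0 ?denq_neq0 // !lognX => /(congr1 odd).
by rewrite oddD !oddM.
Qed.

Theorem mainTheorem3 :
  exists (G : paratopologicalZmodType) (H : zmodClosed G),
    [/\ saturated G, regular_hausdorff G & flat_regular G] /\
    [/\ discrete_subspace [set` H],
        flat_closed [set` H],
        closed [set` H],
        hausdorff_space (quotient_group H)
      & ~ regular_hausdorff (quotient_group H)].
Proof.
pose R : archiRealFieldType := Rdefinitions.R.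
exists (cone_group R), (@graph_subgroup R); split; split.
- exact: cone_group_saturated.
- split; first exact: cone_group_hausdorff.
  exact/flat_regular_regular/cone_group_flat_regular.
- exact: cone_group_flat_regular.
- exact: graph_discrete.
- exact: graph_flat_closed.
- by apply: flat_closed_closed; exact: graph_flat_closed.
- exact: quotient_cone_hausdorff.
- move=> [_]; pose r : Rdefinitions.R := Num.sqrt 2%:R.
  apply: (@quotient_cone_not_regular R r) => q.
  apply: contra (sqr_rat_neq2 q) => /eqP q2; apply/eqP.
  apply: (fmorph_inj (@ratr R)).
  by rewrite rmorphXn /= q2 sqr_sqrtr ?ler0n // ratr_nat.
Qed.
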